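(* There exist an irrational number $\alpha$ and a continuous function $T:S^1\to(0,\infty)$ on the circle $S^1=\mathbb{R}/\mathbb{Z}$ such that the suspension flow $\{\phi^t\}=\mathrm{sus}(R_\alpha,T)$ of the rotation $R_\alpha:S^1\to S^1$, $R_\alpha(x)=x+\alpha$, has the following property: for any $\epsilon>0$ there exists $\delta(\epsilon)>0$ such that whenever two points $x,y$ of the suspension space satisfy $d(\phi^t(x),\phi^t(y))<\delta(\epsilon)$ for every $t>0$, then $y=\phi^s(x)$ for some $s\in(-\epsilon,\epsilon)$.
   Context: Suspension flow: given a homeomorphism $f$ of a compact metric space $Y$ and a continuous function $T:Y\to(0,\infty)$, let $\tilde\phi^t(x,s)=(x,s+t)$ be the translation flow on $Y\times\mathbb{R}$ and let $F:Y\times\mathbb{R}\to Y\times\mathbb{R}$ be the homeomorphism $F(x,t)=(f(x),t-T(x))$. The infinite cyclic group $\langle F\rangle$ acts on $Y\times\mathbb{R}$ freely, properly discontinuously and cocompactly, and commutes with $\tilde\phi^t$ for all $t$. The suspension flow $\mathrm{sus}(f,T)$ of $f$ with return time $T$ is the flow induced by $\tilde\phi$ on the compact quotient $\langle F\rangle\setminus(Y\times\mathbb{R})$ (the suspension space). The quotient is endowed with a metric $d$ compatible with its topology (by compactness, the property in the claim does not depend on the choice of such a metric). *)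

(* Defs.v *)
From HB Require Import structures.
From mathcomp Require Import all_boot all_order all_algebra.
From mathcomp Require Import all_classical all_reals all_analysis.

Set Implicit Arguments.
Unset Strict Implicit.
Unset Printing Implicit Defensive.

Import Order.TTheory GRing.Theory Num.Theory.
Import numFieldNormedType.Exports.

Local Open Scope classical_set_scope.
Local Open Scope ring_scope.
Local Open Scope quotient_scope.

Record homeo (X Y : topologicalType) := Homeo {
  homeo_fun :> X -> Y;
  homeo_inv : Y -> X;
  homeoK : cancel homeo_fun homeo_inv;
  homeoVK : cancel homeo_inv homeo_fun;
  homeo_continuous : continuous homeo_fun;
  homeo_inv_continuous : continuous homeo_inv }.

(* [n]-th iterate, [n : int], of a bijection [g] with inverse [g']. *)
Definition iterz (X : Type) (g g' : X -> X) (n : int) (x : X) : X :=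
  match n with
  | Posz k => iter k g x
  | Negz k => iter k.+1 g' x
  end.

Section iterz.
Variables (X : Type) (g g' : X -> X).
Hypotheses (gK : cancel g g') (g'K : cancel g' g).

Lemma iterzS n x : iterz g g' (n + 1) x = g (iterz g g' n x).
Proof.
case: n => [n|[|n]].
- by rewrite -PoszD addn1.
- by rewrite NegzE addNr /= g'K.
- have -> : Negz n.+1 + 1 = Negz n by rewrite !NegzE -addn1 PoszD opprD subrK.
  by rewrite /= g'K.
Qed.

Lemma iterzB n x : iterz g g' (n - 1) x = g' (iterz g g' n x).
Proof. by rewrite -{2}[n](subrK 1) iterzS gK. Qed.

Lemma iterzD m n x : iterz g g' (m + n) x = iterz g g' m (iterz g g' n x).
Proof.
elim/int_rect: m => [|m IH|m IH]; first by rewrite add0r.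
  by rewrite -addn1 PoszD addrAC !iterzS IH.
by rewrite -addn1 PoszD opprD addrAC !iterzB IH.
Qed.

End iterz.

Section circle.
Variable R : realType.

Definition circle_rel (x y : R) : bool := x - y \is a Num.int.

Lemma circle_rel_refl : reflexive circle_rel.
Proof. by move=> x; rewrite /circle_rel subrr. Qed.

Lemma circle_rel_sym : symmetric circle_rel.
Proof. by move=> x y; rewrite /circle_rel -opprB rpredN. Qed.

Lemma circle_rel_trans : transitive circle_rel.
Proof.
by move=> y x z xy yz; rewrite /circle_rel -(subrKA y) rpredD.
Qed.

Canonical circle_equiv_rel :=
  EquivRel circle_rel circle_rel_refl circle_rel_sym circle_rel_trans.

Definition circle : Type := quotient_topology {eq_quot circle_equiv_rel}.
HB.instance Definition _ := Topological.on circle.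
HB.instance Definition _ := Quotient.on circle.

Lemma circle_eqE (x y : R) :
  \pi_circle x = \pi_circle y <-> x - y \is a Num.int.
Proof.
by split => [|xy]; [move=> /(@eqmodP _ circle_equiv_rel) |
  apply/(@eqmodP _ circle_equiv_rel)].
Qed.

Definition rotation_fun (a : R) (x : circle) : circle := \pi_circle (repr x + a).

Lemma rotation_funE a (x : R) :
  rotation_fun a (\pi_circle x) = \pi_circle (x + a).
Proof.
apply/circle_eqE; rewrite opprD addrACA subrr addr0; apply/circle_eqE.
exact: reprK.
Qed.

Lemma rotation_fun_continuous a : continuous (rotation_fun a).
Proof.
apply/quotient_continuous.
have -> : rotation_fun a \o \pi_circle = \pi_circle \o (fun x => x + a).
  by apply/funext => x; exact: rotation_funE.
move=> x; apply: continuous_comp; last exact: pi_continuous.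
by apply: cvgD; [exact: cvg_id | exact: cvg_cst].
Qed.

Lemma rotation_funK a : cancel (rotation_fun a) (rotation_fun (- a)).
Proof. by move=> x; rewrite rotation_funE addrK; exact: reprK. Qed.

Lemma rotation_funVK a : cancel (rotation_fun (- a)) (rotation_fun a).
Proof. by move=> x; rewrite rotation_funE subrK; exact: reprK. Qed.

Definition rotation (a : R) : homeo circle circle :=
  Homeo (@rotation_funK a) (@rotation_funVK a)
    (@rotation_fun_continuous a) (@rotation_fun_continuous (- a)).

End circle.

(* The suspension space is the quotient of [Y * R] by the group generated by
   [deck], with the quotient topology. Continuity and positivity of the return
   time [T] are not needed for the construction and are left to its users. *)
Section suspension.
Variables (R : realType) (Y : topologicalType) (f : homeo Y Y) (T : Y -> R).

Definition deck (p : Y * R) : Y * R := (f p.1, p.2 - T p.1).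

Definition deck_inv (p : Y * R) : Y * R :=
  (homeo_inv f p.1, p.2 + T (homeo_inv f p.1)).

Lemma deckK : cancel deck deck_inv.
Proof. by move=> [x s]; rewrite /deck /deck_inv /= homeoK subrK. Qed.

Lemma deck_invK : cancel deck_inv deck.
Proof. by move=> [x s]; rewrite /deck /deck_inv /= homeoVK addrK. Qed.

Definition suspension_rel (p q : Y * R) : bool :=
  `[< exists n : int, q = iterz deck deck_inv n p >].

Lemma suspension_rel_refl : reflexive suspension_rel.
Proof. by move=> p; apply/asboolP; exists 0. Qed.

Lemma suspension_rel_sym : symmetric suspension_rel.
Proof.
suff sub p q : suspension_rel p q -> suspension_rel q p.
  by move=> p q; apply/idP/idP; exact: sub.
move=> /asboolP[n ->]; apply/asboolP; exists (- n).
by rewrite -(iterzD deckK deck_invK) addNr.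
Qed.

Lemma suspension_rel_trans : transitive suspension_rel.
Proof.
move=> q p r /asboolP[m ->] /asboolP[n ->]; apply/asboolP; exists (n + m).
by rewrite (iterzD deckK deck_invK).
Qed.

Canonical suspension_equiv_rel := EquivRel suspension_rel
  suspension_rel_refl suspension_rel_sym suspension_rel_trans.

Definition suspension : Type :=
  quotient_topology {eq_quot suspension_equiv_rel}.
HB.instance Definition _ := Topological.on suspension.
HB.instance Definition _ := Quotient.on suspension.

Lemma suspension_eqE (p q : Y * R) : \pi_suspension p = \pi_suspension q <->
  exists n : int, q = iterz deck deck_inv n p.
Proof.
split=> [/(@eqmodP _ suspension_equiv_rel)/asboolP //|pq].
by apply/(@eqmodP _ suspension_equiv_rel)/asboolP.
Qed.

Definition translation (t : R) (p : Y * R) : Y * R := (p.1, p.2 + t).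

(* By [suspension_flowE], this does not depend on the representative. *)
Definition suspension_flow (t : R) (p : suspension) : suspension :=
  \pi_suspension (translation t (repr p)).

Lemma translation_iterz t n p : translation t (iterz deck deck_inv n p) =
  iterz deck deck_inv n (translation t p).
Proof.
have tD q : translation t (deck q) = deck (translation t q).
  by rewrite /translation /deck /= addrAC.
elim/int_rect: n => [//|n IH|n IH].
  by rewrite -addn1 PoszD !(iterzS deck_invK) tD IH.
rewrite -addn1 PoszD opprD !(iterzB deckK deck_invK) -IH.
by apply: (can_inj deckK); rewrite -tD !deck_invK.
Qed.

Lemma suspension_flowE t (p : Y * R) :
  suspension_flow t (\pi_suspension p) = \pi_suspension (translation t p).
Proof.
have /suspension_eqE[n pE] :
  \pi_suspension p = \pi_suspension (repr (\pi_suspension p)).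
  by apply/esym; exact: reprK.
rewrite /suspension_flow pE translation_iterz.
by apply/esym/suspension_eqE; exists n.
Qed.

End suspension.

(* Nonnegativity of [d] follows from the first three axioms. *)
Record compatible_metric (R : realType) (X : topologicalType)
    (d : X -> X -> R) : Prop := CompatibleMetric {
  cmetric_eq0 : forall x y, d x y = 0 <-> x = y;
  cmetric_sym : forall x y, d x y = d y x;
  cmetric_triangle : forall y x z, d x z <= d x y + d y z;
  cmetric_nbhs : forall (x : X) (A : set X),
    nbhs x A <-> exists2 e : R, 0 < e & [set y | d x y < e] `<=` A }.

(* Main.v *)
Require Import Defs.
From mathcomp Require Import all_boot all_order all_algebra.
From mathcomp Require Import all_classical all_reals all_analysis.
From mathcomp Require Import ring lra zify.
Import Order.TTheory GRing.Theory Num.Theory.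
Import numFieldNormedType.Exports.
Local Open Scope classical_set_scope.
Local Open Scope ring_scope.

(* Take [alpha = (sqrt 5 - 1) / 2], [q_n] the Fibonacci numbers 1, 2, 3, 5, ...
   and [T x = 10 + sum_n alpha ^ n cos (2 pi q_n x)].

   If two forward orbits of the suspension flow stay close, then so do suitable
   lifts to [R * R], and comparing heights at the successive returns shows that
   the Birkhoff sums of [x |-> T (x + c) - T x] along one orbit of the rotation
   oscillate by at most a small [eta], where [c] is the displacement between the
   base points. Averaging these sums against the frequency [q_n] by summation by
   parts gives [alpha ^ n |sin (pi q_n c)| <= 2 eta |sin (pi q_n alpha)|] for
   all [n]. As [q_n alpha] is at distance [alpha ^ (n + 2)] from an integer,
   [sin (pi q_n c)] is small for all [n]. But the [q_n] at most double at each
   step, so if [0 < |c| <= 1 / 2] then some [q_n |c|] lies in [1 / 4, 1 / 2], a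
   contradiction. Hence [c = 0] and the two points are on one flow line. *)

(** * Null averages of trigonometric sequences *)

Section trigonometry.
Variable R : realType.
Implicit Types a b x : R.

Lemma sin_sub_sin a b :
  sin (a + b) - sin (a - b) = 2 * (sin b * cos a) :> R.
Proof. by rewrite sinB sinD; ring. Qed.

Lemma cos_sub_cos a b :
  cos (a - b) - cos (a + b) = 2 * (sin a * sin b) :> R.
Proof. by rewrite cosB cosD; ring. Qed.

Lemma norm_sin_le x : `|sin x| <= `|x|.
Proof.
wlog x0 : x / 0 < x.
  move=> W; have [->|xn0] := eqVneq x 0; first by rewrite sin0.
  have [/W//|x0] := ltrP 0 x.
  rewrite -normrN -sinN -(normrN x); apply: W.
  by rewrite oppr_gt0 lt_neqAle xn0.
have [c _] := @MVT R sin cos 0 x x0 (fun x _ => is_derive_sin x)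
  (continuous_subspaceT (@continuous_sin R)).
rewrite sin0 !subr0 => ->; rewrite normrM ler_piMl//; exact: cos_max.
Qed.

Lemma cosD2pi_int x (p : int) : cos (x + 2 * pi * p%:~R) = cos x.
Proof.
have nat_case (y : R) (n : nat) : cos (y + 2 * pi * n%:R) = cos y.
  have <- := periodicn (@cosD2pi R) n y.
  by rewrite -[pi *+ 2 *+ n]mulr_natr -[pi *+ 2]mulr_natl.
case: p => n; first exact: nat_case.
by rewrite NegzE mulrNz mulrN -[LHS](nat_case _ n.+1) subrK.
Qed.

Lemma norm_sinDpi_int x (p : int) : `|sin (x + pi * p%:~R)| = `|sin x|.
Proof.
have nat_case (y : R) (n : nat) : `|sin (y + pi * n%:R)| = `|sin y|.
  have := alternatingn (@sinDpi R) n y.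
  by rewrite mulr_natr => ->; rewrite normrM normrX normrN1 expr1n mul1r.
case: p => n; first exact: nat_case.
by rewrite NegzE mulrNz mulrN -[LHS](nat_case _ n.+1) subrK.
Qed.

(** Subtracting the floor of [x] changes the sine at most by a sign, and the sine is positive
    strictly between 0 and [pi]. *)
Lemma sin_pi_eq0 x : sin (pi * x) = 0 -> x \is a Num.int.
Proof.
move=> sx0; apply/intrP; exists (Num.floor x); apply/eqP; rewrite eq_le.
have /andP[fle] := floor_itv x; rewrite intrD => flt; rewrite fle andbT.
rewrite leNgt; apply/negP => xf.
have := norm_sinDpi_int (pi * x) (- Num.floor x).
rewrite sx0 normr0 => /normr0P/eqP; rewrite mulrNz -mulrDr => s0.
suff : 0 < sin (pi * (x - (Num.floor x)%:~R) : R) by rewrite s0 ltxx.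
apply: sin_gt0_pi; rewrite mulr_gt0 ?pi_gt0 ?subr_gt0//=.
by rewrite gtr_pMr ?pi_gt0// ltrBlDl.
Qed.

Lemma sin_pi_sqr_ge x : 1 / 4 <= x <= 1 / 2 -> 1 / 2 <= sin (pi * x) ^+ 2.
Proof.
move=> /andP[x1 x2]; have pi0 := pi_gt0 R.
suff : cos (pi * x *+ 2) <= 0.
  by rewrite cos_mulr2n cos2sin2 -mulr_natr; lra.
rewrite -oppr_ge0 -[_ *+ 2](subrK pi) cosDpi opprK.
by apply: cos_ge0_pihalf; nra.
Qed.

End trigonometry.

Section null_mean.
Variable R : realType.
Implicit Types v w : nat -> R.

(** Equivalent to partial sums of order [o(N)]. The constant [C] absorbs the initial terms, so that
    no threshold on [N] has to be carried along. *)
Definition null_mean v := forall e : R, 0 < e ->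
  exists C : R, forall N, `|\sum_(k < N) v k| <= e * N%:R + C.

Lemma null_mean_bounded C v :
  (forall N, `|\sum_(k < N) v k| <= C) -> null_mean v.
Proof.
by move=> vC e e0; exists C => N; rewrite ler_wpDl// mulr_ge0// ltW.
Qed.

Lemma null_meanD v w : null_mean v -> null_mean w -> null_mean (v \+ w).
Proof.
move=> nv nw e e0; have e20 : 0 < e / 2 by rewrite divr_gt0.
have [[C vC] [D wD]] := (nv _ e20, nw _ e20).
exists (C + D) => N; rewrite big_split/= (le_trans (ler_normD _ _))//.
by have := lerD (vC N) (wD N); lra.
Qed.

Lemma null_meanZ c v : null_mean v -> null_mean (fun k => c * v k).
Proof.
move=> nv e e0; have c0 : 0 < `|c| + 1 by rewrite ltr_wpDl.
have [C vC] := nv (e / (`|c| + 1)) (divr_gt0 e0 c0).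
exists (`|c| * C) => N; rewrite -mulr_sumr normrM.
apply: (le_trans (ler_wpM2l (normr_ge0 c) (vC N))); rewrite mulrDr lerD2r.
rewrite mulrCA !mulrA ler_wpM2r// mulrAC ler_pdivrMr// ler_wpM2l ?ltW//.
by rewrite ltrDl.
Qed.

Lemma null_mean_sum (M : nat) (F : nat -> nat -> R) :
  (forall m, null_mean (F m)) -> null_mean (fun k => \sum_(m < M) F m k).
Proof.
move=> nF; elim: M => [|M IH].
  apply: (@null_mean_bounded 0) => N.
  by rewrite big1 ?normr0// => k _; rewrite big_ord0.
have := null_meanD _ _ IH (nF M).
by congr null_mean; apply/funext => k/=; rewrite big_ord_recr.
Qed.

(** Closure under uniform limits, which passes from truncations of the roof series to the roof
    itself. *)
Lemma null_mean_unif v :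
  (forall e, 0 < e -> exists2 w, null_mean w & forall k, `|v k - w k| <= e) ->
  null_mean v.
Proof.
move=> vw e e0; have e20 : 0 < e / 2 by rewrite divr_gt0.
have [w nw wv] := vw _ e20; have [C wC] := nw _ e20.
exists C => N.
have -> : \sum_(k < N) v k = \sum_(k < N) (v k - w k) + \sum_(k < N) w k.
  by rewrite -big_split; apply: eq_bigr => k _ /=; rewrite subrK.
rewrite (le_trans (ler_normD _ _))//.
have : `|\sum_(k < N) (v k - w k)| <= e / 2 * N%:R.
  rewrite (le_trans (ler_norm_sum _ _ _))//.
  rewrite (@le_trans _ _ (\sum_(k < N) e / 2))//; first exact: ler_sum.
  by rewrite sumr_const card_ord mulr_natr.
by have := wC N; lra.
Qed.

(** Multiplied by [2 sin (b / 2)], the sum telescopes, so the partial sums stay bounded. *)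
Lemma null_mean_cos (a b : R) :
  sin (b / 2) != 0 -> null_mean (fun k => cos (a + k%:R * b)).
Proof.
move=> sb; apply: (@null_mean_bounded `|sin (b / 2)|^-1) => N.
have -> : \sum_(k < N) cos (a + k%:R * b) =
    (sin (a + N%:R * b - b / 2) - sin (a - b / 2)) / (2 * sin (b / 2)).
  elim: N => [|N IH]; first by rewrite big_ord0 mul0r addr0 subrr mul0r.
  rewrite big_ord_recr/= IH.
  have := sin_sub_sin R (a + N%:R * b) (b / 2).
  have -> : a + N.+1%:R * b - b / 2 = a + N%:R * b + b / 2.
    by rewrite -natr1; field.
  move=> E; have -> : cos (a + N%:R * b) =
    (sin (a + N%:R * b + b / 2) - sin (a + N%:R * b - b / 2))
      / (2 * sin (b / 2)) by rewrite E; field.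
  by field.
rewrite invfM mulrA normrM normfV ler_piMl ?invr_ge0//.
rewrite normrM normfV (ger0_norm (_ : 0 <= 2))// ler_pdivrMr// mul1r.
rewrite (le_trans (ler_normB _ _))//.
by have := sin_max (a + N%:R * b - b / 2); have := sin_max (a - b / 2); lra.
Qed.

Lemma null_mean_le (K L : R) (v : nat -> R) : null_mean v ->
  (forall N, K * N%:R <= L + `|\sum_(k < N) v k|) -> K <= 0.
Proof.
move=> nv KL; rewrite leNgt; apply/negP => K0.
have [C vC] := nv (K / 2) (divr_gt0 K0 (ltr0n _ 2)).
have [N] : exists N : nat, (L + C) / (K / 2) < N%:R.
  exists (Num.bound `|(L + C) / (K / 2)|).
  exact: le_lt_trans (ler_norm _) (archi_boundP (normr_ge0 _)).
rewrite ltr_pdivrMr ?divr_gt0//.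
by have := KL N; have := vC N; lra.
Qed.

(* Summation by parts moves the difference from the bounded [s] to the slowly
   varying [w]. *)
Lemma null_mean_increments (h D K : R) (s w : nat -> R) :
  (forall k, `|s k| <= h) -> (forall k, `|w k| <= 1) ->
  (forall k, `|w k.+1 - w k| <= D) ->
  null_mean (fun k => (s k.+1 - s k) * w k - K) -> `|K| <= h * D.
Proof.
move=> sh w1 wD nK; rewrite -subr_le0.
(* [2 * h] pays for the two boundary terms of the summation by parts. *)
apply: (@null_mean_le _ (2 * h) _ nK) => N.
have -> : \sum_(k < N) ((s k.+1 - s k) * w k - K) =
   s N * w N - s 0 * w 0 - \sum_(k < N) s k.+1 * (w k.+1 - w k) - K * N%:R.
  elim: N => [|N IH]; first by rewrite !big_ord0 mulr0 !subr0 subrr.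
  by rewrite !big_ord_recr/= IH -natr1; ring.
set S := \sum_(k < N) _.
have hS : `|S| <= h * D * N%:R.
  rewrite (le_trans (ler_norm_sum _ _ _))//.
  rewrite (@le_trans _ _ (\sum_(k < N) h * D))//.
    by apply: ler_sum => k _; rewrite normrM ler_pM.
  by rewrite sumr_const card_ord mulr_natr.
have hb k : `|s k * w k| <= h.
  by rewrite normrM -[leRHS]mulr1 ler_pM.
set X := s N * w N - s 0 * w 0 - S.
have := ler_normB X (X - K * N%:R); rewrite subKr normrM normr_nat.
have := ler_normB (s N * w N - s 0 * w 0) S.
have := ler_normB (s N * w N) (s 0 * w 0).
have := hb N; have := hb 0; rewrite mulrBl -/X; lra.
Qed.

End null_mean.

(** * The golden rotation and the roof function *)

(* The Fibonacci numbers from [F_2] on: 1, 2, 3, 5, and so on, without the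
   repetition [F_1 = F_2]. *)
Fixpoint fib (n : nat) : nat :=
  if n is n'.+1 then if n' is m.+1 then (fib n' + fib m)%N else 2%N else 1%N.

Lemma fibS n : fib n.+2 = (fib n.+1 + fib n)%N. Proof. by []. Qed.

Lemma fib_gt0 n : (0 < fib n)%N.
Proof. by elim: n => [|[|n] IH] //; rewrite fibS addn_gt0 IH. Qed.

Lemma fib_ltS n : (fib n < fib n.+1)%N.
Proof. by case: n => // n; rewrite fibS -addn1 leq_add2l fib_gt0. Qed.

Lemma fib_leS2 n : (fib n.+1 <= 2 * fib n)%N.
Proof.
by case: n => // n; rewrite fibS mul2n -addnn leq_add2l ltnW// fib_ltS.
Qed.

Lemma fib_inj : injective fib.
Proof.
have lt := homo_ltn ltn_trans fib_ltS.
by move=> m n E; have [/lt|/lt|//] := ltngtP m n; rewrite E ltnn.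
Qed.

Lemma fib_ge n : (n < fib n)%N.
Proof. by elim: n => // n IH; exact: leq_trans (fib_ltS n). Qed.

Section golden.
Variable R : realType.

Definition golden : R := (Num.sqrt 5 - 1) / 2.

Lemma golden_sqr : golden ^+ 2 = 1 - golden.
Proof.
have : Num.sqrt 5 ^+ 2 = 5 :> R by rewrite sqr_sqrtr.
by rewrite /golden; set s := Num.sqrt 5 => ?; lra.
Qed.

Lemma golden_gt : 3 / 5 < golden.
Proof.
have : Num.sqrt 5 ^+ 2 = 5 :> R by rewrite sqr_sqrtr.
have : 0 <= Num.sqrt 5 :> R by rewrite sqrtr_ge0.
by rewrite /golden; set s := Num.sqrt 5 => ? ?; nra.
Qed.

Lemma golden_lt1 : golden < 1.
Proof. by have := golden_sqr; have := golden_gt; nra. Qed.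

Lemma golden_gt0 : 0 < golden.
Proof. by have := golden_gt; lra. Qed.

Lemma golden_pow_lt (e : R) : 0 < e -> exists n, golden ^+ n < e.
Proof.
move=> e0; have g1 : `|golden| < 1.
  by rewrite ger0_norm ?golden_lt1// ltW// golden_gt0.
have /cvgrPdist_lt/(_ e e0)[N _ /(_ N (leqnn N))] := cvg_expr g1.
rewrite sub0r normrN ger0_norm; first by exists N.
by rewrite exprn_ge0// ltW// golden_gt0.
Qed.

(** Since [golden ^+ 2 = 1 - golden], the powers of [- golden] satisfy the Fibonacci recurrence, so
    the claim propagates by a two-step induction. *)
Lemma fib_golden n : exists p : int,
  (fib n)%:R * golden = p%:~R - (- golden) ^+ n.+2.
Proof.
have g2 := golden_sqr.
suff : (exists p : int, (fib n)%:R * golden = p%:~R - (- golden) ^+ n.+2) /\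
  exists p : int, (fib n.+1)%:R * golden = p%:~R - (- golden) ^+ n.+3 by case.
elim: n => [|n [[p pE] [q qE]]].
  split; exists 1; first by rewrite mul1r sqrrN g2; ring.
  rewrite (_ : _ ^+ 3 = - (golden * golden ^+ 2)); last by ring.
  by rewrite g2 mulrBr -expr2 g2 /=; ring.
split; first by exists q.
exists (q + p).
rewrite fibS natrD mulrDl pE qE intrD.
rewrite (_ : _ ^+ n.+4 = golden ^+ 2 * (- golden) ^+ n.+2); last first.
  by rewrite -addn2 exprD sqrrN mulrC.
by rewrite g2 [(- golden) ^+ n.+3]exprS; ring.
Qed.

(** If [golden] were [a / b], then [b * (- golden) ^+ n.+2] would be a nonzero integer for every
    [n], yet it tends to 0. *)
Lemma golden_irrational : irrational golden.
Proof.
move=> /rationalP[a [b gE]]; have g0 := golden_gt0.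
have b0 : (0 < b)%N.
  by case: b gE => // gE; move: g0; rewrite gE invr0 mulr0 ltxx.
have b0' : 0 < b%:R :> R by rewrite ltr0n.
have [n nb] := golden_pow_lt b%:R^-1 (ltac:(by rewrite invr_gt0)).
have [p pE] := fib_golden n.
have iE : ((p * b%:Z - (fib n)%:Z * a)%:~R : R) = b%:R * (- golden) ^+ n.+2.
  rewrite rmorphB !rmorphM /=.
  have -> : a%:~R = golden * b%:R :> R by rewrite gE divfK// gt_eqF.
  have -> : p%:~R = (fib n)%:R * golden + (- golden) ^+ n.+2.
    by rewrite pE subrK.
  by rewrite /intmul; ring.
have : 0 < `|(p * b%:Z - (fib n)%:Z * a)%:~R : R| < 1.
  rewrite iE normrM normrX normrN gtr0_norm// gtr0_norm//.
  rewrite mulr_gt0// ?exprn_gt0//= mulrC -ltr_pdivlMr// div1r.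
  apply: le_lt_trans nb; apply: ler_wiXn2l; rewrite ?ltW ?golden_lt1//; lia.
rewrite -intr_norm ltr0z ltrz1; lia.
Qed.

Lemma natmul_golden_notint n : (0 < n)%N -> n%:R * golden \isn't a Num.int.
Proof.
move=> n0; apply/negP => /intrP[m mE]; apply: golden_irrational.
apply/rationalP; exists m, n; rewrite -mE mulrAC divff ?mul1r//.
by rewrite pnatr_eq0 -lt0n.
Qed.

Lemma sin_fib_golden n :
  `|sin (pi * ((fib n)%:R * golden))| <= pi * golden ^+ n.+2.
Proof.
have [p ->] := fib_golden n.
rewrite addrC mulrDr norm_sinDpi_int (le_trans (norm_sin_le _ _))//.
rewrite mulrN normrN normrM normrX normrN !ger0_norm ?pi_ge0//.
exact/ltW/golden_gt0.
Qed.

(** The constant 3 rounds up [1 / (1 - golden)], which is about 2.62. *)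
Lemma geometric_golden_le M N :
  (M <= N)%N -> \sum_(M <= k < N) golden ^+ k <= 3 * golden ^+ M.
Proof.
move=> MN; have g1 := golden_lt1; have g0 := golden_gt.
have -> : \sum_(M <= k < N) golden ^+ k =
    (golden ^+ M - golden ^+ N) / (1 - golden).
  rewrite -opprB mulNr -mulrN -(@telescope_sumr _ M N (fun k => golden ^+ k))//.
  rewrite mulr_suml; apply: eq_bigr => k _.
  by rewrite exprS; field; lra.
rewrite ler_pdivrMr ?subr_gt0//; have := golden_sqr.
have := exprn_gt0 M golden_gt0; have := exprn_gt0 N golden_gt0; nra.
Qed.

(** The weights decay at the same rate as the distance from [(fib n)%:R * golden] to the integers;
    this is what makes the bound in [roof_drift_bound] uniform in [n]. *)
Definition roof_term n x : R := golden ^+ n * cos (2 * pi * (fib n)%:R * x).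

(* The constant 10 makes the minimum of [roof] exceed its oscillation, as
   [shadowing_lifts] requires. *)
Definition roof x : R := 10 + limn (series (roof_term^~ x)).

Lemma norm_roof_term n x : `|roof_term n x| <= golden ^+ n.
Proof.
have g0 := exprn_gt0 n golden_gt0.
by rewrite normrM gtr0_norm// ler_piMr ?cos_max// ltW.
Qed.

Lemma roof_approx M x :
  `|roof x - (10 + \sum_(m < M) roof_term m x)| <= 3 * golden ^+ M.
Proof.
have cvg_roof : cvgn (series (roof_term^~ x)).
  apply: normed_cvg.
  apply: (@series_le_cvg _ _ (fun n => golden ^+ n)).
  - by move=> n; exact: normr_ge0.
  - by move=> n; rewrite exprn_ge0// ltW// golden_gt0.
  - by move=> n; exact: norm_roof_term.
  rewrite exprn_geometric; apply: is_cvg_geometric_series.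
  by rewrite ger0_norm ?golden_lt1// ltW// golden_gt0.
have dist N : (M <= N)%N -> 
    `|series (roof_term^~ x) N - \sum_(m < M) roof_term m x| <= 3 * golden ^+ M.
  move=> MN; rewrite -(big_mkord xpredT (roof_term^~ x)) sub_series_geq//.
  rewrite (le_trans (ler_norm_sum _ _ _))//.
  rewrite (le_trans _ (geometric_golden_le M N MN))//.
  by apply: ler_sum => k _; exact: norm_roof_term.
rewrite /roof opprD addrACA subrr add0r ler_norml lerBrDr lerBlDr.
apply/andP; split.
  by apply: limr_ge => //; exists M => // N /= /dist; rewrite ler_norml; lra.
by apply: limr_le => //; exists M => // N /= /dist; rewrite ler_norml; lra.
Qed.

Lemma roof_bounds x : 7 <= roof x <= 13.
Proof.
by have := roof_approx 0 x; rewrite big_ord0 expr0 ler_norml; lra.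
Qed.

Lemma roofD_int x (p : int) : roof (x + p%:~R) = roof x.
Proof.
suff E : roof_term^~ (x + p%:~R) = roof_term^~ x by rewrite /roof E.
apply/funext => n; rewrite /roof_term mulrDr -[_ * _ * p%:~R]mulrA.
by rewrite -[(fib n)%:R * p%:~R](intrM _ (fib n) p) cosD2pi_int.
Qed.

Lemma continuous_roof : continuous roof.
Proof.
move=> x; apply/cvgrPdist_lt => e e0.
(* Each of the two tails is then below [3 * (e / 9) = e / 3]; the last third goes to the truncated
   sum. *)
have [M Me] := golden_pow_lt (e / 9) (divr_gt0 e0 (ltr0n _ 9)).
have cM : {for x, continuous (fun y => \sum_(m < M) roof_term m y)}.
  elim: M {Me} => [|M IH].
    rewrite (_ : (fun y => _) = cst 0); first exact: cvg_cst.
    by apply/funext => y; rewrite big_ord0.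
  rewrite (_ : (fun y => _) =
     (fun y => \sum_(m < M) roof_term m y) \+ roof_term M).
    apply: cvgD => //; apply: cvgM; first exact: cvg_cst.
    apply: continuous_comp; last exact: continuous_cos.
    by apply: cvgM; [exact: cvg_cst|exact: cvg_id].
  by apply/funext => y; rewrite big_ord_recr.
have /cvgrPdist_lt/(_ (e / 3) (divr_gt0 e0 (ltr0n _ 3))) := cM.
apply: filterS => y; have := roof_approx M x; have := roof_approx M y.
by rewrite !ler_norml !ltr_norml; lra.
Qed.

End golden.

(** * Rigidity of bounded drift between two orbits of the golden rotation *)

Section drift.
Variable R : realType.
Local Notation alpha := (golden R).
Variables u c : R.

Let x (k : nat) := u + k%:R * alpha.
(** The argument of the [n]-th cosine at the midpoint of [x k] and [x k + c], so that the difference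
    of the two cosines becomes one product of sines. *)
Let phase (n k : nat) := 2 * pi * (fib n)%:R * x k + pi * ((fib n)%:R * c).

Lemma roof_term_sub m k :
  roof_term R m (x k + c) - roof_term R m (x k) =
  - (2 * (alpha ^+ m * (sin (phase m k) * sin (pi * ((fib m)%:R * c))))).
Proof.
have := cos_sub_cos R (phase m k) (pi * ((fib m)%:R * c)).
have -> : phase m k - pi * ((fib m)%:R * c) = 2 * pi * (fib m)%:R * x k.
  by rewrite /phase addrK.
have -> : phase m k + pi * ((fib m)%:R * c) = 2 * pi * (fib m)%:R * (x k + c).
  by rewrite /phase; ring.
move=> E; rewrite /roof_term -mulrBr -opprB E; ring.
Qed.

(** Orthogonality of frequencies: the product splits into cosines of frequencies [fib m + fib n] and
    [fib m - fib n]. Nonzero frequencies average to 0 because [golden] is irrational; for [m = n]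
    the zero frequency leaves a constant, which the added term cancels. *)
Lemma null_mean_roof_term m n : null_mean R (fun k =>
  (roof_term R m (x k + c) - roof_term R m (x k)) * sin (phase n k) +
    (if m == n then alpha ^+ n * sin (pi * ((fib n)%:R * c)) else 0)).
Proof.
pose b (d : R) := 2 * pi * d * u + pi * (d * c).
have nm (d : R) : d * alpha \isn't a Num.int ->
    null_mean R (fun k => cos (b d + k%:R * (2 * pi * (d * alpha)))).
  move=> dN; apply: null_mean_cos; apply: contra dN => /eqP E.
  by apply: sin_pi_eq0; rewrite -E; congr sin; field.
have phaseD k : phase m k + phase n k =
    b ((fib m)%:R + (fib n)%:R) +
    k%:R * (2 * pi * (((fib m)%:R + (fib n)%:R) * alpha)).
  by rewrite /phase /b /x; ring.
have phaseB k : phase m k - phase n k =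
    b ((fib m)%:R - (fib n)%:R) +
    k%:R * (2 * pi * (((fib m)%:R - (fib n)%:R) * alpha)).
  by rewrite /phase /b /x; ring.
have sumN : ((fib m)%:R + (fib n)%:R) * alpha \isn't a Num.int.
  by rewrite -natrD natmul_golden_notint// addn_gt0 fib_gt0.
have E k : (roof_term R m (x k + c) - roof_term R m (x k)) * sin (phase n k) =
    alpha ^+ m * sin (pi * ((fib m)%:R * c)) * cos (phase m k + phase n k) +
    - (alpha ^+ m * sin (pi * ((fib m)%:R * c))) * cos (phase m k - phase n k).
  by rewrite roof_term_sub !mulNr -mulrBr -opprB cos_sub_cos; ring.
have [mn|mn] := eqVneq m n.
  rewrite -mn in E phaseD sumN *.
  have := null_meanZ R (alpha ^+ m * sin (pi * ((fib m)%:R * c))) _ (nm _ sumN).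
  congr null_mean; apply/funext => k; rewrite E subrr cos0 mulr1 subrK.
  by rewrite phaseD.
have difN : ((fib m)%:R - (fib n)%:R) * alpha \isn't a Num.int.
  have [/ltnW le|le] := ltnP (fib m) (fib n).
    rewrite -opprB mulNr rpredN -natrB// natmul_golden_notint// subn_gt0.
    by rewrite ltn_neqAle le andbT; apply: contra mn => /eqP/fib_inj->.
  rewrite -natrB// natmul_golden_notint// subn_gt0.
  by rewrite ltn_neqAle le andbT; apply: contra mn => /eqP/fib_inj->.
have := null_meanD R _ _
  (null_meanZ R (alpha ^+ m * sin (pi * ((fib m)%:R * c))) _ (nm _ sumN))
  (null_meanZ R (- (alpha ^+ m * sin (pi * ((fib m)%:R * c)))) _ (nm _ difN)).
by congr null_mean; apply/funext => k; rewrite addr0 E phaseD phaseB.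
Qed.

Lemma null_mean_roof n : null_mean R (fun k =>
  (roof R (x k + c) - roof R (x k)) * sin (phase n k) +
    alpha ^+ n * sin (pi * ((fib n)%:R * c))).
Proof.
apply: null_mean_unif => e e0.
have [M0 M0e] := golden_pow_lt R (e / 6) (divr_gt0 e0 (ltr0n _ 6)).
(* The truncation must contain the index [n], the only one that contributes a constant. With
   [e / 6], the two tails together stay below [e]. *)
pose M := (M0 + n.+1)%N.
have Me : alpha ^+ M < e / 6.
  apply: le_lt_trans M0e; apply: ler_wiXn2l; rewrite ?leq_addr//.
    exact/ltW/golden_gt0.
  exact/ltW/golden_lt1.
eexists; first exact: (null_mean_sum R M _ (null_mean_roof_term ^~ n)).
move=> k /=; rewrite big_split/= -mulr_suml.
have nM : (n < M)%N by rewrite /M; lia.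
rewrite [X in _ - (_ + X)](bigD1 (Ordinal nM))//= eqxx.
rewrite [X in _ - (_ + (_ + X))]big1 ?addr0; last first.
  by move=> i; rewrite -val_eqE/= => /negbTE->.
rewrite [X in _ - X]addrC addrKA -mulrBl normrM.
rewrite (le_trans (ler_piMr (normr_ge0 _) (sin_max _)))//.
have := roof_approx R M (x k + c); have := roof_approx R M (x k).
rewrite sumrB !ler_norml; lra.
Qed.

Lemma roof_drift_bound (h : R) (s : nat -> R) n :
  (forall k, `|s k| <= h) ->
  (forall k, s k.+1 - s k = roof R (x k) - roof R (x k + c)) ->
  `|sin (pi * ((fib n)%:R * c))| <= 2 * pi * h.
Proof.
move=> sh sS; have g0 := golden_gt0 R; have gn0 := exprn_gt0 n g0.
have h0 : 0 <= h by exact: le_trans (sh 0%N).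
have : `|alpha ^+ n * sin (pi * ((fib n)%:R * c))| <=
    h * (2 * `|sin (pi * ((fib n)%:R * alpha))|).
  apply: (@null_mean_increments R _ _ _ s (fun k => sin (phase n k))) => //.
  - by move=> k; exact: sin_max.
  - move=> k; set y := phase n k + pi * ((fib n)%:R * alpha).
    have -> : phase n k.+1 = y + pi * ((fib n)%:R * alpha).
      by rewrite /y /phase /x -natr1; ring.
    have -> : phase n k = y - pi * ((fib n)%:R * alpha) by rewrite addrK.
    rewrite sin_sub_sin !normrM (ger0_norm (_ : 0 <= 2))//.
    by rewrite ler_wpM2l// ler_piMr// cos_max.
  have := null_meanZ R (- 1) _ (null_mean_roof n).
  congr null_mean; apply/funext => k; rewrite sS; ring.
rewrite normrM gtr0_norm//.
have := sin_fib_golden R n; have pi0 := pi_gt0 R.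
(* Both sides now carry [alpha ^+ n], which cancels; the remaining factor [1 - alpha] is bounded by
   1. *)
rewrite -addn2 exprD golden_sqr.
have := golden_lt1 R; set S' := sin _; set S := sin _ => g1 S'le Sle.
have : alpha ^+ n * `|S| <= alpha ^+ n * (2 * pi * h).
  apply: (le_trans Sle).
  have : h * (2 * `|S'|) <= h * (2 * (pi * (alpha ^+ n * (1 - alpha)))).
    by rewrite ler_wpM2l// ler_wpM2l.
  move/le_trans; apply.
  rewrite (_ : h * _ = (1 - alpha) * (alpha ^+ n * (2 * pi * h))); last by ring.
  rewrite ler_piMl//; last lra.
  by rewrite !mulr_ge0// ltW.
by rewrite ler_pM2l.
Qed.

Lemma roof_drift_rigid (s : nat -> R) : `|c| <= 1 / 2 ->
  (forall k, `|s k| <= 1 / 20) ->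
  (forall k, s k.+1 - s k = roof R (x k) - roof R (x k + c)) -> c = 0.
Proof.
move=> c2 sh sS; apply/eqP; apply: contraT; rewrite -normr_gt0 => c0.
have ex : exists n, 1 / 4 <= (fib n)%:R * `|c|.
  exists (Num.bound `|c|^-1).
  rewrite -ler_pdivrMr//; apply: (@le_trans _ _ `|c|^-1).
    by rewrite ler_piMl ?invr_ge0//; lra.
  apply/ltW/(lt_trans (archi_boundP _)); first by rewrite invr_ge0.
  by rewrite ltr_nat fib_ge.
(* At the least such [n] the product is still at most [1 / 2]: the previous one is below [1 / 4] and
   [fib] at most doubles, while for [n = 0] this is the hypothesis on [c]. *)
case: (ex_minnP ex) => n nge nmin.
have nle : (fib n)%:R * `|c| <= 1 / 2.
  case: n nge nmin => [|n] _ nmin; first by rewrite [leLHS]mul1r.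
  have : (fib n)%:R * `|c| < 1 / 4.
    by rewrite ltNge; apply/negP => /nmin; rewrite ltnn.
  have : (fib n.+1)%:R <= 2 * (fib n)%:R :> R.
    by rewrite -natrM ler_nat fib_leS2.
  by move=> /(ler_wpM2r (normr_ge0 c)); lra.
have := sin_pi_sqr_ge R ((fib n)%:R * `|c|) (ltac:(by rewrite nge nle)).
have -> : sin (pi * ((fib n)%:R * `|c|)) ^+ 2 =
    `|sin (pi * ((fib n)%:R * c))| ^+ 2.
  rewrite real_normK ?num_real//; have [_|_] := ger0P c => //.
  by rewrite !mulrN sinN sqrrN.
(* With [h = 1 / 20] the sine is at most [2 * 4 / 20 = 2 / 5], whose square is below [1 / 2]. *)
have := roof_drift_bound _ _ n sh sS; have pi4 : pi < 4 :> R.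
  by have /andP[_] := pihalf_02 R; lra.
by have := normr_ge0 (sin (pi * ((fib n)%:R * c))); set S := `|_| => ? ? ?; nra.
Qed.

End drift.

(** * Lifting orbits of a suspension of a rotation *)

Lemma continuous_pair (A B C : topologicalType) (f : A -> B) (g : A -> C) :
  continuous f -> continuous g -> continuous (fun x => (f x, g x)).
Proof.
move=> cf cg x.
by apply: (@cvg_pair _ _ _ _ (nbhs (f x)) (nbhs (g x))); [exact: cf|exact: cg].
Qed.

Lemma continuous_iter (A : topologicalType) (f : A -> A) n :
  continuous f -> continuous (iter n f).
Proof.
move=> cf; elim: n => [|n IH] x /=; first exact: cvg_id.
by apply: (@continuous_comp _ _ _ (iter n f) f); [exact: IH|exact: cf].
Qed.

Section circle_suspension.
Local Open Scope quotient_scope.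
Variables (R : realType) (alpha : R) (T : circle R -> R).
Hypothesis cT : continuous T.
Local Notation Y := (circle R).
Local Notation X := (suspension (rotation alpha) T).
Local Notation deck := (@deck R Y (rotation alpha) T).
Local Notation deck_inv := (@deck_inv R Y (rotation alpha) T).

(** Coordinates from the plane, so that displacements along the base are real numbers. *)
Definition susp_pt (u s : R) : X := \pi_X (\pi_Y u, s).

Lemma susp_pt_surj (x : X) : exists u s, x = susp_pt u s.
Proof.
exists (repr (repr x).1), (repr x).2.
by rewrite /susp_pt reprK -surjective_pairing reprK.
Qed.

Lemma suspension_flow_pt t u s :
  suspension_flow t (susp_pt u s) = susp_pt u (s + t).
Proof. exact: suspension_flowE. Qed.

Lemma susp_pt_deck u s : susp_pt u s = susp_pt (u + alpha) (s - T (\pi_Y u)).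
Proof.
apply/suspension_eqE; exists 1.
by rewrite /= /Defs.deck /= rotation_funE.
Qed.

Lemma susp_ptD_int u s (p : int) : susp_pt (u + p%:~R) s = susp_pt u s.
Proof.
rewrite /susp_pt; congr (\pi_X (_, s)); apply/circle_eqE.
by rewrite addrC addKr intr_int.
Qed.

Lemma circle_pi_inj (u v : R) : \pi_Y u = \pi_Y v -> `|u - v| < 1 -> u = v.
Proof.
move=> /circle_eqE/intrP[p pE]; rewrite pE -intr_norm ltrz1 => p1.
have p0 : p = 0 by lia.
by apply/eqP; rewrite -subr_eq0 pE p0.
Qed.

(** A nontrivial power of the deck transformation changes the height by at least [m], so only the
    trivial one can relate the two points. *)
Lemma susp_pt_inj (m u v s t : R) : (forall z, m <= T z) ->
  susp_pt u s = susp_pt v t -> `|u - v| < 1 -> `|s - t| < m ->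
  u = v /\ s = t.
Proof.
move=> mT /suspension_eqE[n nE] uv st.
have m0 : 0 < m by exact: le_lt_trans (normr_ge0 _) st.
have deck_le k (p : Y * R) : (iter k deck p).2 <= p.2.
  elim: k => //= k IH; rewrite lerBlDr (le_trans IH)// lerDl.
  exact: le_trans (ltW m0) (mT _).
have deck_inv_ge k (p : Y * R) : p.2 <= (iter k deck_inv p).2.
  elim: k => //= k IH; rewrite (le_trans IH)// lerDl.
  exact: le_trans (ltW m0) (mT _).
have [sE|] := n =P 0.
  move: nE; rewrite sE => -[uE ->]; split => //.
  exact: circle_pi_inj (esym uE) uv.
case: n nE => [[//|k]|k] nE _; move: st; rewrite ltr_norml => /andP[].
  have : t = (iter k deck (\pi_Y u, s)).2 - T (iter k deck (\pi_Y u, s)).1.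
    by have := congr1 snd nE.
  have := deck_le k (\pi_Y u, s); set z := T _; have : m <= z := mT _.
  by move=> /=; lra.
have : t = (iter k deck_inv (\pi_Y u, s)).2 +
    T (homeo_inv (rotation alpha) (iter k deck_inv (\pi_Y u, s)).1).
  by have := congr1 snd nE.
have := deck_inv_ge k (\pi_Y u, s); set z := T _; have : m <= z := mT _.
by move=> /=; lra.
Qed.

Lemma continuous_deck : continuous deck.
Proof.
apply: continuous_pair => p.
  apply: (@continuous_comp _ _ _ fst (rotation_fun alpha)).
    exact: cvg_fst.
  exact: rotation_fun_continuous.
apply: cvgB; first exact: cvg_snd.
by apply: (@continuous_comp _ _ _ fst T); [exact: cvg_fst|exact: cT].
Qed.

Lemma continuous_deck_inv : continuous deck_inv.
Proof.
have c1 : continuous (fun q : Y * R => rotation_fun (- alpha) q.1).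
  move=> p; apply: (@continuous_comp _ _ _ fst (rotation_fun (- alpha))).
    exact: cvg_fst.
  exact: rotation_fun_continuous.
apply: continuous_pair => // p; apply: cvgD; first exact: cvg_snd.
apply: (@continuous_comp _ _ _ (fun q : Y * R => rotation_fun (- alpha) q.1) T).
  exact: c1.
exact: cT.
Qed.

Lemma continuous_iterz n : continuous (iterz deck deck_inv n).
Proof.
case: n => k; first exact/continuous_iter/continuous_deck.
exact: (continuous_iter _ _ k.+1 continuous_deck_inv).
Qed.

Lemma continuous_susp_pt s : continuous (susp_pt^~ s).
Proof.
have cs : continuous (fun v => (\pi_Y v, s)).
  by apply: continuous_pair => v; [exact: pi_continuous|exact: cvg_cst].
move=> u; apply: (@continuous_comp _ _ _ (fun v => (\pi_Y v, s)) \pi_X).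
  exact: cs.
exact: pi_continuous.
Qed.

Lemma circle_pi_open (A : set R) : open A -> open (\pi_Y @` A).
Proof.
move=> oA; suff : open (\pi_Y @^-1` (\pi_Y @` A)) by [].
rewrite openE => v [w Aw wv].
have nA : nbhs (v + (w - v)) A by rewrite addrC subrK; exact: open_nbhs_nbhs.
have cv : continuous (fun y : R => y + (w - v)).
  by move=> y; apply: cvgD; [exact: cvg_id|exact: cvg_cst].
apply: (@filterS _ (nbhs v) _ _ _ _ (cv v A nA)) => y /= Ay.
exists (y + (w - v)) => //.
by apply/circle_eqE; rewrite addrC addKr; apply/circle_eqE.
Qed.

(** The projection is open: near any lift of a point of the set, a fixed continuous deck iterate
    carries nearby lifts into the box. *)
Lemma nbhs_susp_pt (u s e : R) : 0 < e -> nbhs (susp_pt u s)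
  [set y | exists v t, [/\ y = susp_pt v t, `|v - u| < e & `|t - s| < e]].
Proof.
move=> e0; pose B := [set y : X | exists v t,
  [/\ y = susp_pt v t, `|v - u| < e & `|t - s| < e]].
suff oB : open B.
  by apply: open_nbhs_nbhs; split => //; exists u, s; rewrite !subrr normr0.
suff : open (\pi_X @^-1` B) by [].
rewrite openE => w [v [t [/esym/suspension_eqE[n nE] vu ts]]].
have nK : iterz deck deck_inv (- n) w = (\pi_Y v, t).
  by rewrite nE -(iterzD (@deckK _ _ _ _) (@deck_invK _ _ _ _)) addNr.
have : nbhs (iterz deck deck_inv (- n) w)
    ((\pi_Y @` [set v' | `|v' - u| < e]) `*` [set t' : R | `|t' - s| < e]).
  rewrite nK; exists
    (\pi_Y @` [set v' | `|v' - u| < e], [set t' | `|t' - s| < e]) => //.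
  have ob (z : R) : open [set z' | `|z' - z| < e].
    by rewrite (_ : mkset _ = ball z e); [exact: ball_open|
      apply/seteqP; split => z' /=; rewrite /ball/= distrC].
  split; last by apply: open_nbhs_nbhs; split => //; exact: ob.
  apply: open_nbhs_nbhs; split; first exact/circle_pi_open/ob.
  by exists v.
move=> /(continuous_iterz (- n) w) nw.
apply: (@filterS _ (nbhs w) _ _ _ _ nw) => w' [[v' v'u vE] t's].
exists v', (iterz deck deck_inv (- n) w').2; split => //.
rewrite /susp_pt vE -surjective_pairing.
by apply/suspension_eqE; exists (- n).
Qed.

(* Uniformity in [u] comes from the compactness of [0, 1], to which every [u]
   is reduced by an integer translation. *)
Lemma susp_pt_lift (d : X -> X -> R) (s e : R) : compatible_metric d -> 0 < e ->
  exists2 delta, 0 < delta & forall u y, d (susp_pt u s) y < delta ->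
    exists v t, [/\ y = susp_pt v t, `|v - u| < e & `|t - s| < e].
Proof.
move=> dm e0; have e20 : 0 < e / 2 by rewrite divr_gt0.
pose P delta u := forall y, d (susp_pt u s) y < delta ->
    exists v t, [/\ y = susp_pt v t, `|v - u| < e & `|t - s| < e].
have cK : near_covering (`[0, 1] : set R).
  exact/compact_near_coveringP/segment_compact.
have : \forall delta \near 0^'+, `[0, 1] `<=` P delta.
  apply: cK => u _.
  have /(cmetric_nbhs dm)[r r0 rsub] := nbhs_susp_pt u s _ e20.
  have r20 : 0 < r / 2 by rewrite divr_gt0.
  have U1 : nbhs (susp_pt u s) [set y | d (susp_pt u s) y < r / 2].
    by apply/(cmetric_nbhs dm); exists (r / 2).
  (* Two halves of [r] cover the way from [u] through [u'] to [y]; two halves of [e] allow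
     recentring from [u] to [u']. *)
  exists ([set u' | d (susp_pt u s) (susp_pt u' s) < r / 2 /\
                    `|u' - u| < e / 2],
          [set delta | delta < r / 2]); first split.
  - have U3 : nbhs u [set u' | `|u' - u| < e / 2].
      by apply/nbhs_ballP; exists (e / 2) => //= z; rewrite /ball/= distrC.
    exact: (@filterI _ (nbhs u) _ _ _ (continuous_susp_pt s u _ U1) U3).
  - exact: nbhs_right_lt.
  move=> [u' delta] [/= [du' u'u] dr] y dy.
  have [|v [t [yE vu ts]]] := rsub y.
    rewrite /= (le_lt_trans (cmetric_triangle dm (susp_pt u' s) _ _))//; lra.
  exists v, t; split => //; last by lra.
  by move: vu u'u; rewrite !ltr_norml; lra.
move=> /(filterI (nbhs_right_gt 0)) /filter_ex[delta [delta0 dP]].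
exists delta => // u y.
have E : susp_pt u s = susp_pt (u - (Num.floor u)%:~R) s.
  by rewrite -[RHS](susp_ptD_int _ _ (Num.floor u)) subrK.
rewrite E => /dP[|v [t [-> vu ts]]].
  by rewrite /= in_itv/=; have /andP[] := floor_itv u; rewrite intrD; lra.
exists (v + (Num.floor u)%:~R), t; split => //; first by rewrite susp_ptD_int.
by rewrite (_ : _ - u = v - (u - (Num.floor u)%:~R)) //; ring.
Qed.

End circle_suspension.

(** * Successive returns to a height, and expansivity from rigidity *)

Section expansive.
Local Open Scope quotient_scope.
Variables (R : realType) (alpha : R) (T : circle R -> R).
Hypothesis cT : continuous T.
Variable m : R.
Hypotheses (m1 : 1 <= m) (mT : forall z, m <= T z).
Hypothesis oscT : forall z z', `|T z - T z'| <= m - 1.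
Local Notation X := (suspension (rotation alpha) T).
Local Notation susp_pt := (susp_pt R alpha T).
Local Notation T' u := (T (\pi_(circle R) u)).

Lemma suspension_flowD (s t : R) (x : X) :
  suspension_flow (s + t) x = suspension_flow t (suspension_flow s x).
Proof.
have [u [r ->]] := susp_pt_surj R alpha T x.
by rewrite !suspension_flow_pt addrA.
Qed.

Lemma suspension_flow0 (x : X) : suspension_flow 0 x = x.
Proof.
have [u [r ->]] := susp_pt_surj R alpha T x.
by rewrite suspension_flow_pt addr0.
Qed.

(** Each deck step lowers the height by at least [m >= 1], so finitely many bring it below [s], from
    where the flow rises to [s]. A positive time is required as closeness is assumed only for
    [t > 0]. *)
Lemma suspension_flow_hits (s : R) (x : X) :
  exists2 t : R, 0 < t & exists u, suspension_flow t x = susp_pt u s.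
Proof.
have [u0 [r0 ->]] := susp_pt_surj R alpha T x.
suff main n (u r : R) : r < s + n%:R ->
    exists2 t : R, 0 < t &
      exists v, suspension_flow t (susp_pt u r) = susp_pt v s.
  apply: (main (Num.bound `|r0 - s|)); rewrite -ltrBlDl.
  exact: le_lt_trans (ler_norm _) (archi_boundP (normr_ge0 _)).
elim: n u r => [|n IH] u r rs.
  exists (s - r); first by rewrite addr0 in rs; rewrite subr_gt0.
  by exists u; rewrite suspension_flow_pt addrC subrK.
rewrite susp_pt_deck; apply: IH; set z := T _; have mz : m <= z := mT _.
by move: rs m1; rewrite -natr1; lra.
Qed.

Definition birkhoff_sum (u : R) (k : nat) := \sum_(j < k) T' (u + j%:R * alpha).

Lemma suspension_flow_birkhoff u s k :
  suspension_flow (birkhoff_sum u k) (susp_pt u s) =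
  susp_pt (u + k%:R * alpha) s.
Proof.
rewrite suspension_flow_pt; elim: k => [|k IH].
  by rewrite /birkhoff_sum big_ord0 mul0r !addr0.
rewrite /birkhoff_sum big_ord_recr/= addrA -suspension_flow_pt IH.
rewrite suspension_flow_pt susp_pt_deck addrK -natr1.
by congr susp_pt; ring.
Qed.

(* The lifts of the second orbit near the returns of the first one form a single
   orbit of the deck group, since a deck transformation moves the heights by
   more than the available room. *)
Lemma shadowing_lifts (d : X -> X -> R) (e : R) : compatible_metric d ->
  0 < e -> e < 1 / 2 ->
  exists2 delta, 0 < delta & forall u (y : X),
    (forall k, d (susp_pt (u + k%:R * alpha) 1)
                 (suspension_flow (birkhoff_sum u k) y) < delta) ->
    exists c (t : nat -> R), [/\ y = susp_pt (u + c) (t 0), `|c| < e,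
      forall k, `|t k - 1| < e &
      forall k, t k.+1 - t k =
        T' (u + k%:R * alpha) - T' (u + k%:R * alpha + c)].
Proof.
move=> dm e0 e12.
have [delta delta0 lift] := susp_pt_lift R alpha T cT d 1 e dm e0.
exists delta => // u y dy.
have /choice[vt vtE] : forall k, exists vt : R * R,
    [/\ suspension_flow (birkhoff_sum u k) y = susp_pt vt.1 vt.2,
        `|vt.1 - (u + k%:R * alpha)| < e & `|vt.2 - 1| < e].
  by move=> k; have [v [t ?]] := lift _ _ (dy k); exists (v, t).
have step k : (vt k).1 + alpha = (vt k.+1).1 /\
    (vt k).2 + T' (u + k%:R * alpha) - T' (vt k).1 = (vt k.+1).2.
  have [E1 v1 t1] := vtE k; have [E2 v2 t2] := vtE k.+1.
  apply: (susp_pt_inj R alpha T m) => //.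
  - rewrite -susp_pt_deck -suspension_flow_pt -E1 -E2 -suspension_flowD.
    by rewrite /birkhoff_sum big_ord_recr.
  - by move: v1 v2; rewrite -natr1 !ltr_norml; lra.
  (* The oscillation is at most [m - 1], and the two height errors, each below [1 / 2], keep the
     total under [m]. *)
  - have := oscT (\pi_(circle R) (u + k%:R * alpha)) (\pi_(circle R) (vt k).1).
    by move: t1 t2; rewrite ler_norml !ltr_norml; lra.
have vk k : (vt k).1 = u + k%:R * alpha + ((vt 0).1 - u).
  elim: k => [|k IH]; first by ring.
  by have [<- _] := step k; rewrite IH -natr1; ring.
exists ((vt 0).1 - u), (snd \o vt); split.
- have [E0 _ _] := vtE 0.
  by rewrite addrC subrK -E0 /birkhoff_sum big_ord0 suspension_flow0.
- by have [_ v0 _] := vtE 0; move: v0; rewrite mul0r addr0.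
- by move=> k; have [] := vtE k.
move=> k; have [_] := step k; rewrite -vk /= => <-; ring.
Qed.

(** Flow [x] to height 1, lift the orbit of [y] at its returns, let rigidity identify the base
    points, and flow back. *)
Lemma suspension_expansive (eta : R) : 0 < eta ->
  (forall u c (s : nat -> R), `|c| <= 1 / 2 -> (forall k, `|s k| <= eta) ->
    (forall k, s k.+1 - s k =
      T' (u + k%:R * alpha) - T' (u + k%:R * alpha + c)) -> c = 0) ->
  forall d : X -> X -> R, compatible_metric d ->
  forall eps : R, 0 < eps ->
  exists2 delta : R, 0 < delta &
    forall x y : X,
      (forall t : R, 0 < t ->
         d (suspension_flow t x) (suspension_flow t y) < delta) ->
      exists2 s : R, - eps < s < eps & y = suspension_flow s x.
Proof.
move=> eta0 rigid d dm eps eps0.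
(* [eps] bounds the final time shift, [eta] feeds the rigidity hypothesis, and [1 / 4] keeps [e]
   below the [1 / 2] of [shadowing_lifts]. *)
pose e := Num.min eps (Num.min eta (1 / 4)).
have e0 : 0 < e by rewrite !lt_min eps0 eta0/=; lra.
have eeps : e <= eps by rewrite ge_min lexx.
have eeta : e <= eta by rewrite !ge_min lexx orbT.
have e4 : e <= 1 / 4 by rewrite !ge_min lexx !orbT.
have e2 : e < 1 / 2 by lra.
have [delta delta0 shadow] := shadowing_lifts d e dm e0 e2.
exists delta => // x y xy.
have [t0 t00 [u xE]] := suspension_flow_hits 1 x.
have [|c [t [yE ce te tE]]] := shadow u (suspension_flow t0 y).
  move=> k; rewrite -suspension_flow_birkhoff -xE -!suspension_flowD.
  apply: xy; apply: ltr_wpDr => //; apply: sumr_ge0 => j _.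
  exact: le_trans (le_trans ler01 m1) (mT _).
have c0 : c = 0.
  apply: (rigid u c (fun k => t k - 1)).
  - by apply/ltW/(lt_trans ce).
  - by move=> k; apply/ltW/(lt_le_trans (te k)).
  - by move=> k; rewrite -tE; ring.
(* At time [t0] the two points lie over the same [u], at heights 1 and [t 0]. *)
exists (t 0 - 1).
  by have := te 0; rewrite ltr_norml; lra.
have back (z : X) : z = suspension_flow (- t0) (suspension_flow t0 z).
  by rewrite -suspension_flowD subrr suspension_flow0.
rewrite [LHS]back [x]back yE xE c0 addr0 !suspension_flow_pt.
by congr susp_pt; ring.
Qed.

End expansive.

(** * The suspension of the golden rotation *)

Theorem mainTheorem2 (R : realType) :
  exists (alpha : R) (T : circle R -> R),
    [/\ irrational alpha,
        continuous T,
        (forall x : circle R, 0 < T x) &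
        forall d : suspension (rotation alpha) T ->
                   suspension (rotation alpha) T -> R,
          compatible_metric d ->
          forall eps : R, 0 < eps ->
          exists2 delta : R, 0 < delta &
            forall x y : suspension (rotation alpha) T,
              (forall t : R, 0 < t ->
                 d (suspension_flow t x) (suspension_flow t y) < delta) ->
              exists2 s : R, - eps < s < eps & y = suspension_flow s x].
Proof.
have roof_pi (a b : R) : \pi_(circle R)%qT a = \pi_(circle R)%qT b ->
    roof R a = roof R b.
  move=> /circle_eqE/intrP[p pE].
  by rewrite -(roofD_int R b p) -pE addrC subrK.
pose T : circle R -> R := roof R \o repr.
have TE (a : R) : T (\pi_(circle R)%qT a) = roof R a.
  by apply: roof_pi; exact: reprK.
have cT : continuous T.
  apply/quotient_continuous.
  rewrite (_ : _ \o _ = roof R); last by apply/funext => a; exact: TE.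
  exact: continuous_roof.
have T7 z : 7 <= T z by have /andP[] := roof_bounds R (repr z).
exists (golden R), T; split => //; first exact: golden_irrational.
  by move=> z; exact: lt_le_trans (T7 z).
have oscT z z' : `|T z - T z'| <= 7 - 1.
  have := roof_bounds R (repr z); have := roof_bounds R (repr z').
  by rewrite ler_norml /T/=; lra.
(* The roof lies between 7 and 13, hence [m = 7] with oscillation at most 6; [1 / 20] is the
   threshold of [roof_drift_rigid]. *)
apply: (suspension_expansive R (golden R) T cT 7 _ T7 oscT (1 / 20)) => //.
- by rewrite ler1n.
- move=> u c s c2 sh sS; apply: (roof_drift_rigid R u c s c2 sh) => k.
  by rewrite sS !TE.
Qed.
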